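(* Let $\mathcal{X}$ be a finite set, $\pi\in\mathcal{P}(\mathcal{X})$, and $P_0,P_1$ transition matrices on $\mathcal{X}$. Put $Q_i(x,y)=\pi(x)P_i(x,y)$ for $i=0,1$, let $\pi_0,\pi_1$ be prior probabilities with $\pi_0+\pi_1=1$, $0<\pi_0<1$, and define the best achievable Bayesian error $$P_e^*(n):=\inf_{A_n\subseteq(\mathcal{X}\times\mathcal{X})^n}\left\{\pi_0Q_0^n(A_n)+\pi_1Q_1^n(A_n^c)\right\}.$$ Then $$\lim_{n\to\infty}-\frac1n\ln P_e^*(n)=C(P_0,P_1),$$ where $C(P_0,P_1)$ is the Chernoff information between $P_0$ and $P_1$ with respect to $\pi$.
   Context: $\mathcal{P}(\mathcal{X})$ is the set of probability mass functions on $\mathcal{X}$; $\pi$ need not be stationary for $P_0$ or $P_1$. $Q_i$ is a probability measure on $\mathcal{X}\times\mathcal{X}$ and $Q_i^n$ is its $n$-fold product measure on $(\mathcal{X}\times\mathcal{X})^n$ (the law of $n$ i.i.d. pairs $(X_j,Y_j)$ with $X_j\sim\pi$, $Y_j\mid X_j\sim P_i(X_j,\cdot)$). The Chernoff information is $$C(P_0,P_1):=\max_{0\le\alpha\le1}(1-\alpha)R_\alpha(P_0\|P_1)=\max_{0\le\alpha\le1}-\ln\sum_{x,y}\pi(x)P_0^\alpha(x,y)P_1^{1-\alpha}(x,y),$$ where $R_\alpha$ is the Rényi divergence of order $\alpha$, the sum is understood to run over pairs $(x,y)$ with $P_0(x,y)>0$ and $P_1(x,y)>0$, and $-\ln0=+\infty$.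 *)

(* Defs.v *)
From HB Require Import structures.
From mathcomp Require Import all_boot all_order all_algebra.
From mathcomp Require Import all_classical all_reals all_analysis.

Set Implicit Arguments.
Unset Strict Implicit.
Unset Printing Implicit Defensive.
Import Order.TTheory GRing.Theory Num.Theory.
Import numFieldNormedType.Exports.

Local Open Scope classical_set_scope.
Local Open Scope ring_scope.

Definition is_pmf (R : realType) (T : finType) (p : T -> R) : Prop :=
  (forall x, 0 <= p x) /\ \sum_x p x = 1.

Definition is_transition_matrix (R : realType) (X : finType)
    (P : X -> X -> R) : Prop :=
  forall x, is_pmf (P x).

Definition pair_law (R : realType) (X : finType) (pi : X -> R)
    (P : X -> X -> R) (z : X * X) : R :=
  pi z.1 * P z.1 z.2.

(* On a finite space every set is measurable and a measure is given by its
   point masses, so the n-fold product measure is written out as a finite sum. *)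
Definition prod_measure (R : realType) (T : finType) (Q : T -> R) (n : nat)
    (A : {set n.-tuple T}) : R :=
  \sum_(z in A) \prod_(i < n) Q (tnth z i).

Definition bayes_error (R : realType) (X : finType) (pi : X -> R)
    (P0 P1 : X -> X -> R) (pi0 pi1 : R) (n : nat)
    (A : {set n.-tuple (X * X)}) : R :=
  pi0 * prod_measure (pair_law pi P0) A
  + pi1 * prod_measure (pair_law pi P1) (~: A).

Definition best_bayes_error (R : realType) (X : finType) (pi : X -> R)
    (P0 P1 : X -> X -> R) (pi0 pi1 : R) (n : nat) : R :=
  inf (range (@bayes_error R X pi P0 P1 pi0 pi1 n)).

(* The restriction to common positivity matters at alpha = 0 and alpha = 1,
   because 0 `^ 0 = 1. *)
Definition chernoff_sum (R : realType) (X : finType) (pi : X -> R)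
    (P0 P1 : X -> X -> R) (alpha : R) : R :=
  \sum_(z : X * X | (0 < P0 z.1 z.2) && (0 < P1 z.1 z.2))
     pi z.1 * P0 z.1 z.2 `^ alpha * P1 z.1 z.2 `^ (1 - alpha).

(* Meaningful for alpha != 1; lne 0 = -oo. *)
Definition renyi_divergence (R : realType) (X : finType) (pi : X -> R)
    (P0 P1 : X -> X -> R) (alpha : R) : \bar R :=
  ((alpha - 1)^-1%:E * lne (chernoff_sum pi P0 P1 alpha)%:E)%E.

(* The supremum is a maximum: see chernoff_information_max. *)
Definition chernoff_information (R : realType) (X : finType) (pi : X -> R)
    (P0 P1 : X -> X -> R) : \bar R :=
  ereal_sup [set (- lne (chernoff_sum pi P0 P1 alpha)%:E)%E
            | alpha in [set a : R | 0 <= a <= 1]].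

Lemma renyi_divergenceE (R : realType) (X : finType) (pi : X -> R)
    (P0 P1 : X -> X -> R) (alpha : R) : alpha < 1 ->
  ((1 - alpha)%:E * renyi_divergence pi P0 P1 alpha
   = - lne (chernoff_sum pi P0 P1 alpha)%:E)%E.
Proof.
move=> a1; rewrite /renyi_divergence muleA -EFinM.
suff -> : (1 - alpha) * (alpha - 1)^-1 = -1 by rewrite mulN1e.
by rewrite -opprB mulNr divff// subr_eq0 lt_eqF.
Qed.

Lemma continuous_chernoff_sum (R : realType) (X : finType) (pi : X -> R)
    (P0 P1 : X -> X -> R) : continuous (chernoff_sum pi P0 P1).
Proof.
rewrite /chernoff_sum; apply: continuous_big; first exact: add_continuous.
move=> z /andP[p0 p1] a.
have powc (c : R) (f : R -> R) : 0 < c -> f t @[t --> a] --> f a ->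
    c `^ f t @[t --> a] --> c `^ f a.
  move=> c0 fa; rewrite /powR gt_eqF//.
  apply: (cvg_comp (fun t => f t * ln c) expR); last exact: continuous_expR.
  exact: cvgMr_tmp.
apply: cvgM.
  by apply: cvgMl_tmp; apply: (powc _ id).
apply: (powc _ (fun t => 1 - t)) => //.
by apply: cvgB; [exact: cvg_cst|exact: cvg_id].
Qed.

Lemma chernoff_sum_ge0 (R : realType) (X : finType) (pi : X -> R)
    (P0 P1 : X -> X -> R) (alpha : R) : (forall x, 0 <= pi x) ->
  0 <= chernoff_sum pi P0 P1 alpha.
Proof.
by move=> pi0; apply: sumr_ge0 => z _; rewrite !mulr_ge0 ?powR_ge0.
Qed.

Lemma chernoff_information_max (R : realType) (X : finType) (pi : X -> R)
    (P0 P1 : X -> X -> R) : (forall x, 0 <= pi x) ->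
  exists2 alpha : R, 0 <= alpha <= 1 &
    chernoff_information pi P0 P1
    = (- lne (chernoff_sum pi P0 P1 alpha)%:E)%E.
Proof.
move=> pi0.
have [c c01 cmin] := @EVT_min R (chernoff_sum pi P0 P1) 0 1 ler01
  (continuous_subspaceT (@continuous_chernoff_sum _ _ pi P0 P1)).
have {}c01 : 0 <= c <= 1 by move: c01; rewrite in_itv.
exists c => //; apply/eqP; rewrite eq_le; apply/andP; split.
  apply: ge_ereal_sup => _ [a a01 <-].
  rewrite leeN2 lee_lne ?in_itv/= ?leey ?lee_fin ?chernoff_sum_ge0//.
  by apply: cmin; rewrite in_itv.
by apply: ereal_sup_ubound; exists c.
Qed.

(* Main.v *)
Require Import Defs.
From mathcomp Require Import all_boot all_order all_algebra.
From mathcomp Require Import all_classical all_reals all_analysis.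
From mathcomp Require Import ring lra.
Import Order.TTheory GRing.Theory Num.Theory.
Import numFieldNormedType.Exports.
Local Open Scope classical_set_scope.
Local Open Scope ring_scope.

(* Let c be the Chernoff sum at its minimiser alpha, u the summand there
   (extended by 0), p = u / c, and l = ln (P0 / P1).  The optimal error lies,
   up to the constant min(pi0, pi1), between sums of min(Q0^n, Q1^n), where
   Q0 = u e^((1 - alpha) l) and Q1 = u e^(- alpha l) on the common support.
   Upper bound: one of the two exponents summed along a tuple is nonpositive,
   so min(Q0^n, Q1^n) <= u^n, which sums to c^n.
   Lower bound: minimality of alpha gives (1 - alpha) m >= 0 >= alpha m for the
   p-mean m of l, hence min(Q0^n, Q1^n) >= c^n p^n e^(- |L|), where L is the
   centred sum of l.  By Jensen, sum p^n e^(- |L|) >= e^(- E|L|), and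
   E|L| = O(sqrt n) because the variance of L is linear in n.
   When c = 0 the upper bound alone gives both sides equal to +oo. *)

(** * Sums over tuples, by splitting off the first entry *)

Lemma sum_tupleS (V : nmodType) (T : finType) (n : nat)
    (F : n.+1.-tuple T -> V) :
  \sum_z F z = \sum_x \sum_(z : n.-tuple T) F (cons_tuple x z).
Proof.
rewrite pair_bigA/= (reindex (fun p : T * n.-tuple T => cons_tuple p.1 p.2))//=.
exists (fun z : n.+1.-tuple T => (thead z, behead_tuple z)) => [[x z]|z] _ /=.
  by congr pair; apply/val_inj.
by rewrite [RHS]tuple_eta; apply/val_inj.
Qed.

Lemma prod_cons_tuple (R : comPzRingType) (T : finType) (n : nat) (p : T -> R)
    (x : T) (z : n.-tuple T) :
  \prod_(i < n.+1) p (tnth (cons_tuple x z) i)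
  = p x * \prod_(i < n) p (tnth z i).
Proof.
rewrite big_ord_recl tnth0; congr (_ * _).
by apply: eq_bigr => i _; rewrite tnthS.
Qed.

Lemma sum_cons_tuple (V : nmodType) (T : finType) (n : nat) (f : T -> V)
    (x : T) (z : n.-tuple T) :
  \sum_(i < n.+1) f (tnth (cons_tuple x z) i)
  = f x + \sum_(i < n) f (tnth z i).
Proof.
rewrite big_ord_recl tnth0; congr (_ + _).
by apply: eq_bigr => i _; rewrite tnthS.
Qed.

Lemma sum_prod_tuple (R : comPzRingType) (T : finType) (p : T -> R) (n : nat) :
  \sum_(z : n.-tuple T) \prod_(i < n) p (tnth z i) = (\sum_x p x) ^+ n.
Proof.
elim: n => [|n IH].
  rewrite (eq_bigr (fun=> 1)) => [|z _]; last by rewrite big_ord0.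
  by rewrite sumr_const card_tuple expn0 expr0.
rewrite sum_tupleS exprS mulr_suml; apply: eq_bigr => x _.
by rewrite -IH mulr_sumr; apply: eq_bigr => z _; rewrite prod_cons_tuple.
Qed.

(** * Mean and variance of a sum of i.i.d. centred terms *)

Section iid_moments.
Context {R : comPzRingType} {T : finType} (p f : T -> R).
Hypotheses (p1 : \sum_x p x = 1) (pf0 : \sum_x p x * f x = 0).

Lemma iid_sum_mean (n : nat) :
  \sum_(z : n.-tuple T) (\prod_(i < n) p (tnth z i)) *
    (\sum_(i < n) f (tnth z i)) = 0.
Proof.
elim: n => [|n IH]; first by apply: big1 => z _; rewrite !big_ord0 mulr0.
rewrite sum_tupleS -[RHS]pf0; apply: eq_bigr => x _.
rewrite (eq_bigr (fun z : n.-tuple T => p x * f x * \prod_(i < n) p (tnth z i)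
  + p x * ((\prod_(i < n) p (tnth z i)) * \sum_(i < n) f (tnth z i)))).
  rewrite big_split/= -!mulr_sumr IH mulr0 addr0 sum_prod_tuple p1.
  by rewrite expr1n mulr1.
by move=> z _; rewrite prod_cons_tuple sum_cons_tuple; ring.
Qed.

(** Splitting off the first entry and expanding the square leaves a cross term that is a multiple of
    the mean of the remaining sum, hence zero by [iid_sum_mean]. *)
Lemma iid_sum_variance (n : nat) :
  \sum_(z : n.-tuple T) (\prod_(i < n) p (tnth z i)) *
    (\sum_(i < n) f (tnth z i)) ^+ 2 = (\sum_x p x * f x ^+ 2) *+ n.
Proof.
elim: n => [|n IH].
  by apply: big1 => z _; rewrite !big_ord0 expr0n mulr0.
rewrite sum_tupleS mulrS -IH -[X in _ = _ + X]mul1r -[X in _ = _ + X * _]p1.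
rewrite mulr_suml -big_split/=.
apply: eq_bigr => x _.
rewrite (eq_bigr (fun z : n.-tuple T =>
  p x * f x ^+ 2 * \prod_(i < n) p (tnth z i)
  + (p x * f x *+ 2 * ((\prod_(i < n) p (tnth z i)) *
                      \sum_(i < n) f (tnth z i))
  + p x * ((\prod_(i < n) p (tnth z i)) *
           (\sum_(i < n) f (tnth z i)) ^+ 2)))).
  rewrite !big_split/= -!mulr_sumr iid_sum_mean mulr0 add0r sum_prod_tuple.
  by rewrite p1 expr1n mulr1.
by move=> z _; rewrite prod_cons_tuple sum_cons_tuple; ring.
Qed.

End iid_moments.

(** * Exponential tilting: two-sided bounds on the sum of minima *)

Section tilting.
Context {R : realType} {T : finType} (q0 q1 u l : T -> R) (a b : R).
Hypotheses (a01 : 0 <= a <= 1) (b01 : 0 <= b <= 1).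
Hypothesis u_ge0 : forall z, 0 <= u z.
(** The section is applied with a = 1 - alpha and b = alpha. Only inequalities can be asked for
    here: off the common support [u] is 0, while [q0] or [q1] may be positive. *)
Hypothesis uq0 : forall z, u z * expR (a * l z) <= q0 z.
Hypothesis uq1 : forall z, u z * expR (- b * l z) <= q1 z.
Hypothesis quE : forall z, q0 z != 0 -> q1 z != 0 ->
  q0 z = u z * expR (a * l z) /\ q1 z = u z * expR (- b * l z).

Lemma prod_tilt (t : R) (n : nat) (z : n.-tuple T) :
  \prod_(i < n) (u (tnth z i) * expR (t * l (tnth z i)))
  = (\prod_(i < n) u (tnth z i)) * expR (t * \sum_(i < n) l (tnth z i)).
Proof. by rewrite big_split/= -expR_sum mulr_sumr. Qed.

Lemma min_prod_le_tilt (n : nat) (z : n.-tuple T) :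
  Num.min (\prod_(i < n) q0 (tnth z i)) (\prod_(i < n) q1 (tnth z i))
  <= \prod_(i < n) u (tnth z i).
Proof.
have U0 : 0 <= \prod_(i < n) u (tnth z i) by apply: prodr_ge0.
(* If either product vanishes, the minimum is at most 0; otherwise every factor is nonzero and [quE]
   applies along the whole tuple. *)
have [Q0|/prodf_neq0 Q0] := eqVneq (\prod_(i < n) q0 (tnth z i)) 0.
  by rewrite ge_min Q0 U0.
have [Q1|/prodf_neq0 Q1] := eqVneq (\prod_(i < n) q1 (tnth z i)) 0.
  by rewrite ge_min Q1 U0 orbT.
have quEz (i : 'I_n) := quE _ (Q0 i isT) (Q1 i isT).
under eq_bigr do rewrite (proj1 (quEz _)).
under [X in Num.min _ X]eq_bigr do rewrite (proj2 (quEz _)).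
rewrite !prod_tilt ge_min.
have [/andP[a0 _] /andP[b0 _]] := (a01, b01).
have [L0|L0] := leP 0 (\sum_(i < n) l (tnth z i)).
  by apply/orP; right; rewrite ler_piMr// -expR0 ler_expR; nra.
by apply/orP; left; rewrite ler_piMr// -expR0 ler_expR; nra.
Qed.

Lemma sum_min_le_tilt (n : nat) :
  \sum_(z : n.-tuple T)
    Num.min (\prod_(i < n) q0 (tnth z i)) (\prod_(i < n) q1 (tnth z i))
  <= (\sum_z u z) ^+ n.
Proof.
by rewrite -sum_prod_tuple; apply: ler_sum => z _; exact: min_prod_le_tilt.
Qed.

Let c := \sum_z u z.
Let p z := u z / c.
Let m := \sum_z p z * l z.
Hypothesis c0 : 0 < c.
(** First-order condition at the minimiser: with a = 1 - alpha and b = alpha, an interior alpha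
    forces m = 0, whereas at an endpoint only the sign of m is fixed. *)
Hypotheses (am : 0 <= a * m) (bm : b * m <= 0).

Let L n (z : n.-tuple T) := \sum_(i < n) (l (tnth z i) - m).

Lemma min_prod_ge_tilt (n : nat) (z : n.-tuple T) :
  c ^+ n * ((\prod_(i < n) p (tnth z i)) * expR (- `|L n z|)) <=
  Num.min (\prod_(i < n) q0 (tnth z i)) (\prod_(i < n) q1 (tnth z i)).
Proof.
have -> : c ^+ n * ((\prod_(i < n) p (tnth z i)) * expR (- `|L n z|))
    = (\prod_(i < n) u (tnth z i)) * expR (- `|L n z|).
  rewrite mulrA; congr (_ * _).
  have -> : c ^+ n = \prod_(i < n) c by rewrite prodr_const card_ord.
  rewrite -big_split/=.
  by apply: eq_bigr => i _; rewrite /p mulrC divfK// gt_eqF.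
have LE : \sum_(i < n) l (tnth z i) = L n z + m * n%:R.
  by rewrite /L sumrB sumr_const card_ord mulr_natr subrK.
have U0 : 0 <= \prod_(i < n) u (tnth z i) by apply: prodr_ge0.
have [/andP[a0 a1] /andP[b0 b1]] := (a01, b01).
have [n0 absL0] : 0 <= n%:R :> R /\ 0 <= `|L n z| by [].
have [Lle Lge] : L n z <= `|L n z| /\ - `|L n z| <= L n z.
  by rewrite ler_norm lerNl -normrN ler_norm.
rewrite le_min; apply/andP; split.
  apply: (@le_trans _ _
    (\prod_(i < n) (u (tnth z i) * expR (a * l (tnth z i))))).
    rewrite prod_tilt ler_wpM2l// ler_expR LE mulrDr mulrA.
    have : 0 <= a * m * n%:R by rewrite mulr_ge0.
    nra.
  by apply: ler_prod => i _; rewrite uq0 mulr_ge0 ?expR_ge0.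
apply: (@le_trans _ _
  (\prod_(i < n) (u (tnth z i) * expR (- b * l (tnth z i))))).
  rewrite prod_tilt ler_wpM2l// ler_expR LE mulrDr mulrA !mulNr.
  have : b * m * n%:R <= 0 by rewrite mulr_le0_ge0.
  nra.
by apply: ler_prod => i _; rewrite uq1 mulr_ge0 ?expR_ge0.
Qed.

Let p_ge0 z : 0 <= p z.
Proof. by rewrite divr_ge0// ltW. Qed.

Let p1 : \sum_z p z = 1.
Proof. by rewrite -mulr_suml divff// gt_eqF. Qed.

Let v := \sum_z p z * (l z - m) ^+ 2.

Lemma sum_min_ge_tilt (n : nat) : (0 < n)%N ->
  c ^+ n * expR (- (Num.sqrt n%:R * ((1 + v) / 2))) <=
  \sum_(z : n.-tuple T)
    Num.min (\prod_(i < n) q0 (tnth z i)) (\prod_(i < n) q1 (tnth z i)).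
Proof.
move=> n0.
apply: le_trans (ler_sum _ (fun z _ => min_prod_ge_tilt n z)).
rewrite -mulr_sumr; apply: ler_wpM2l; first by rewrite exprn_ge0// ltW.
(* [K] is to bound the p-mean of |L|: the choice s = sqrt n makes s / 2 and n v / (2 s) of the same
   order, with sum s (1 + v) / 2. *)
set s := Num.sqrt n%:R; set K := s * _.
have s0 : 0 < s by rewrite sqrtr_gt0 ltr0n.
have pm0 : \sum_z p z * (l z - m) = 0.
  under eq_bigr do rewrite mulrBr.
  by rewrite sumrB -mulr_suml p1 mul1r subrr.
(* AM-GM: |L| <= (s + L^2/s)/2 *)
have EL : \sum_(z : n.-tuple T) (\prod_(i < n) p (tnth z i)) * `|L n z| <= K.
  apply: (@le_trans _ _ (\sum_(z : n.-tuple T)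
      (s / 2 * (\prod_(i < n) p (tnth z i)) +
       (2 * s)^-1 * ((\prod_(i < n) p (tnth z i)) * L n z ^+ 2)))).
    apply: ler_sum => z _.
    have -> : s / 2 * (\prod_(i < n) p (tnth z i)) +
       (2 * s)^-1 * ((\prod_(i < n) p (tnth z i)) * L n z ^+ 2) =
       (\prod_(i < n) p (tnth z i)) * ((s ^+ 2 + `|L n z| ^+ 2) / (2 * s)).
      by rewrite real_normK ?num_real//; field; rewrite gt_eqF.
    rewrite ler_wpM2l ?prodr_ge0// ler_pdivlMr ?mulr_gt0//.
    by have := sqr_ge0 (s - `|L n z|); nra.
  rewrite big_split/= -!mulr_sumr sum_prod_tuple p1 expr1n.
  rewrite (iid_sum_variance p (fun z => l z - m))//.
  rewrite -/v -[v *+ n]mulr_natr -[n%:R]sqr_sqrtr// -/s /K.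
  by rewrite le_eqVlt; apply/predU1P; left; field; rewrite gt_eqF.
(* Jensen via the tangent line of exp at - K: e^(- |L|) >= e^(- K) (1 + K - |L|), and the mean of
   the last factor is at least 1 by [EL]. *)
apply: (@le_trans _ _ (\sum_(z : n.-tuple T)
    expR (- K) * ((\prod_(i < n) p (tnth z i)) * (1 + (K - `|L n z|))))).
  rewrite -mulr_sumr -[X in X <= _]mulr1 ler_wpM2l ?expR_ge0//.
  have -> : \sum_(z : n.-tuple T)
      (\prod_(i < n) p (tnth z i)) * (1 + (K - `|L n z|)) =
      \sum_(z : n.-tuple T) ((1 + K) * (\prod_(i < n) p (tnth z i))
        - (\prod_(i < n) p (tnth z i)) * `|L n z|).
    by apply: eq_bigr => z _; ring.
  by rewrite sumrB -mulr_sumr sum_prod_tuple p1 expr1n; lra.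
apply: ler_sum => z _.
rewrite mulrCA ler_wpM2l ?prodr_ge0//.
have -> : expR (- `|L n z|) = expR (- K) * expR (K - `|L n z|).
  by rewrite -expRD; congr expR; ring.
by rewrite ler_wpM2l ?expR_ge0// expR_ge1Dx.
Qed.

End tilting.

(** * Reduction of the Bayes error to the sum of minima *)

Section bayes.
Context {R : realType} {X : finType} (pi : X -> R) (P0 P1 : X -> X -> R).
Context (pi0 pi1 : R).
Hypotheses (pi00 : 0 <= pi0) (pi10 : 0 <= pi1).
Let q0 := pair_law pi P0.
Let q1 := pair_law pi P1.

(** Each tuple contributes exactly one of its two weighted masses, chosen by membership in [A], so
    the error can be minimised tuple by tuple. *)
Lemma best_bayes_errorE (n : nat) :
  best_bayes_error pi P0 P1 pi0 pi1 n =
  \sum_(z : n.-tuple (X * X)) Num.min (pi0 * \prod_(i < n) q0 (tnth z i))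
                                     (pi1 * \prod_(i < n) q1 (tnth z i)).
Proof.
have bE (A : {set n.-tuple (X * X)}) : bayes_error pi P0 P1 pi0 pi1 A =
    \sum_(z : n.-tuple (X * X))
      if z \in A then pi0 * \prod_(i < n) q0 (tnth z i)
      else pi1 * \prod_(i < n) q1 (tnth z i).
  rewrite /bayes_error /prod_measure !mulr_sumr (bigID (mem A) xpredT)/=.
  congr (_ + _).
    by apply: eq_bigr => z ->.
  by apply: eq_big => [z|z]; rewrite inE// => /negbTE ->.
set M := \sum_z Num.min _ _.
have lb : lbound (range (@bayes_error R X pi P0 P1 pi0 pi1 n)) M.
  move=> _ [A _ <-]; rewrite bE; apply: ler_sum => z _.
  by case: ifP => _; rewrite ge_min lexx ?orbT.
apply/le_anti/andP; split; last first.
  by apply: lb_le_inf => //; eexists; exists finset.set0.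
apply: ge_inf; first by exists M.
(* The likelihood-ratio test attains the infimum; ties go to the complement. *)
exists [set z : n.-tuple (X * X) |
  pi0 * \prod_(i < n) q0 (tnth z i) <
  pi1 * \prod_(i < n) q1 (tnth z i)]%SET => //.
by rewrite bE; apply: eq_bigr => z _; rewrite inE.
Qed.

Lemma best_bayes_error_le (n : nat) : pi0 <= 1 -> pi1 <= 1 ->
  (forall z, 0 <= q0 z) -> (forall z, 0 <= q1 z) ->
  best_bayes_error pi P0 P1 pi0 pi1 n <=
  \sum_(z : n.-tuple (X * X))
    Num.min (\prod_(i < n) q0 (tnth z i)) (\prod_(i < n) q1 (tnth z i)).
Proof.
move=> pi0_le1 pi1_le1 q0_ge0 q1_ge0; rewrite best_bayes_errorE.
apply: ler_sum => z _; apply: le_min2; apply: ler_piMl => //; exact: prodr_ge0.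
Qed.

(** The factor lost to the priors does not depend on [n], so it disappears from the exponent. *)
Lemma best_bayes_error_ge (n : nat) :
  (forall z, 0 <= q0 z) -> (forall z, 0 <= q1 z) ->
  Num.min pi0 pi1 * (\sum_(z : n.-tuple (X * X))
    Num.min (\prod_(i < n) q0 (tnth z i)) (\prod_(i < n) q1 (tnth z i))) <=
  best_bayes_error pi P0 P1 pi0 pi1 n.
Proof.
move=> q0_ge0 q1_ge0; rewrite best_bayes_errorE mulr_sumr.
have k0 : 0 <= Num.min pi0 pi1 by rewrite le_min pi00.
apply: ler_sum => z _; rewrite le_min; apply/andP; split.
  by apply: ler_pM; rewrite ?ge_min ?lexx// le_min !prodr_ge0.
by apply: ler_pM; rewrite ?ge_min ?lexx ?orbT// le_min !prodr_ge0.
Qed.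

End bayes.

(** * Analytic tools: first-order condition, powers, limit of exponents *)

(** The conclusion concerns the right derivative at t = 0 of the sum of w e^(t d l), which is
    minimal there. Instead of differentiating, the increment from 0 to t is bounded by t g(t), so g
    >= 0 on (0, 1], and continuity carries this to g(0). *)
Lemma expR_sum_min_mean (R : realType) (T : finType) (w l : T -> R) (d : R) :
  (forall z, 0 <= w z) ->
  (forall t, 0 < t <= 1 -> \sum_z w z <= \sum_z w z * expR (t * d * l z)) ->
  0 <= d * \sum_z w z * l z.
Proof.
move=> w0 wmin.
pose g (t : R) := \sum_z w z * (d * l z) * expR (t * (d * l z)).
have -> : d * \sum_z w z * l z = g 0.
  rewrite mulr_sumr; apply: eq_bigr => z _.
  by rewrite mul0r expR0 mulr1 mulrCA.
(* e^y - 1 <= y e^y *)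
have g_ge0 t : 0 < t <= 1 -> 0 <= g t.
  move=> t01; have /andP[t0 _] := t01; rewrite -(pmulr_rge0 _ t0).
  apply: (@le_trans _ _
    (\sum_z w z * expR (t * d * l z) - \sum_z w z)).
    by rewrite subr_ge0 wmin.
  rewrite -sumrB mulr_sumr; apply: ler_sum => z _.
  have : (1 - t * d * l z) * expR (t * d * l z) <= 1.
    by rewrite -ler_pdivlMr ?expR_gt0// div1r -expRN; exact: expR_ge1Dx.
  rewrite (_ : t * (d * l z) = t * d * l z) ?mulrA//.
  have := w0 z; have := expR_gt0 (t * d * l z); nra.
have g_cont : continuous g.
  rewrite /g; apply: continuous_big; first exact: add_continuous.
  move=> z _ t.
  apply: cvgMl_tmp; apply: (cvg_comp (fun t : R => t * (d * l z)) expR).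
    by apply: cvgMr_tmp; exact: cvg_id.
  exact: continuous_expR.
rewrite leNgt; apply/negP => g0.
have : \forall t \near 0^'+, g t < 0.
  by apply: (cvgr_lt (g 0)) => //; apply: cvg_at_right_filter; exact: g_cont.
move=> g_lt0.
near (0 : R)^'+ => t.
have : 0 <= g t.
  apply: g_ge0; apply/andP; split; near: t.
    exact: nbhs_right_gt.
  exact: nbhs_right_le.
by rewrite leNgt; apply/negP/negPn; near: t.
Unshelve. all: by end_near. Qed.

(** Tilting by [t] moves the order from alpha to alpha + t; t = 1 - alpha recovers x and t = - alpha
    recovers y. *)
Lemma powR_tilt (R : realType) (x y alpha t : R) : 0 < x -> 0 < y ->
  x `^ alpha * y `^ (1 - alpha) * expR (t * (ln x - ln y)) =
  x `^ (alpha + t) * y `^ (1 - (alpha + t)).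
Proof.
move=> x0 y0; rewrite /powR !gt_eqF// -!expRD; congr expR; ring.
Qed.

Lemma cvg_exponent (R : realType) (e : nat -> R) (c k K : R) :
  0 < c -> 0 < k -> (forall n, (0 < n)%N -> e n <= c ^+ n) ->
  (forall n, (0 < n)%N ->
    k * (c ^+ n * expR (- (Num.sqrt n%:R * K))) <= e n) ->
  (fun n : nat => - ((n%:R^-1)%:E * lne (e n)%:E))%E @ \oo --> (- ln c)%:E.
Proof.
move=> c0 k0 e_le e_ge; rewrite -cvg_shiftS.
have e0 n : 0 < e n.+1.
  apply: lt_le_trans (e_ge _ _) => //.
  by rewrite !mulr_gt0 ?exprn_gt0 ?expR_gt0.
pose x n : R := - (n.+1%:R^-1 * ln (e n.+1)).
rewrite (_ : [sequence _]_n = EFin \o x); last first.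
  apply/funext => n.
  by rewrite -[LHS]/(- ((n.+1%:R^-1)%:E * lne (e n.+1)%:E))%E lne_EFin.
apply: cvg_EFin; first exact: nearW.
(* [harmonic n] is 1 / (n + 1), so the upper envelope is the lower bound on [e] after taking - ln
   and dividing by n + 1; both error terms vanish. *)
apply: (@squeeze_cvgr _ _ _ _ (fun=> - ln c)
  (fun n => - ln c + (- ln k * harmonic n + K * Num.sqrt (harmonic n)))).
- apply: nearW => n /=; rewrite /x.
  have n0 : 0 < n.+1%:R :> R by rewrite ltr0n.
  have le1 : ln (e n.+1) <= n.+1%:R * ln c.
    rewrite mulr_natl -lnXn// ler_ln ?posrE ?exprn_gt0//; exact: e_le.
  have le2 : ln k + n.+1%:R * ln c - Num.sqrt n.+1%:R * K <= ln (e n.+1).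
    apply: (@le_trans _ _
      (ln (k * (c ^+ n.+1 * expR (- (Num.sqrt n.+1%:R * K)))))).
      by rewrite !lnM ?posrE ?mulr_gt0 ?exprn_gt0 ?expR_gt0// lnXn//
        expRK mulr_natl addrA.
    rewrite ler_ln ?posrE ?e_ge//.
    by rewrite !mulr_gt0 ?exprn_gt0 ?expR_gt0.
  apply/andP; split.
    by rewrite lerN2 mulrC ler_pdivrMr// mulrC.
  rewrite /harmonic sqrtrV//.
  have s0 : 0 < Num.sqrt n.+1%:R :> R by rewrite sqrtr_gt0.
  rewrite -(ler_pM2l n0) mulrN mulrA divff ?gt_eqF// mul1r.
  suff -> : n.+1%:R * (- ln c + (- ln k / n.+1%:R + K * (Num.sqrt n.+1%:R)^-1))
    = - (ln k + n.+1%:R * ln c - Num.sqrt n.+1%:R * K) by rewrite lerN2.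
  rewrite -[n.+1%:R]sqr_sqrtr ?ltW// sqrtr_sqr ger0_norm ?ltW//.
  by field; rewrite gt_eqF.
- exact: cvg_cst.
- rewrite -[X in _ --> X]addr0; apply: cvgD; first exact: cvg_cst.
  rewrite -[X in _ --> X]addr0; apply: cvgD.
    rewrite -[X in _ --> X](mulr0 (- ln k)); apply: cvgMl_tmp.
    exact: cvg_harmonic.
  rewrite -[X in _ --> X](mulr0 K); apply: cvgMl_tmp.
  rewrite -[X in _ --> X]sqrtr0.
  apply: (cvg_comp harmonic Num.sqrt); first exact: cvg_harmonic.
  exact: sqrt_continuous.
Qed.

(** * Assembly at the minimiser of the Chernoff sum *)

Theorem theorem4p2 (R : realType) (X : finType) (pi : X -> R)
    (P0 P1 : X -> X -> R) (pi0 pi1 : R)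
    (hpi : is_pmf pi)
    (hP0 : is_transition_matrix P0) (hP1 : is_transition_matrix P1)
    (hprior : pi0 + pi1 = 1) (hpi0 : 0 < pi0 < 1) :
  (fun n : nat =>
     (- ((n%:R^-1)%:E * lne (best_bayes_error pi P0 P1 pi0 pi1 n)%:E))%E)
    @ \oo --> chernoff_information pi P0 P1.
Proof.
have [pi_ge0 _] := hpi.
have P0_ge0 x y : 0 <= P0 x y by apply: (hP0 x).1.
have P1_ge0 x y : 0 <= P1 x y by apply: (hP1 x).1.
have [pi00 pi10 pi01 pi11] : [/\ 0 < pi0, 0 < pi1, pi0 <= 1 & pi1 <= 1].
  by case/andP: hpi0 => ? ?; split; lra.
have [alpha alpha01 CE] := chernoff_information_max P0 P1 pi_ge0.
(* Minimality of the sum is read back from the supremum attained at [alpha], as - ln is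
   decreasing. *)
have cmin beta : 0 <= beta <= 1 ->
    chernoff_sum pi P0 P1 alpha <= chernoff_sum pi P0 P1 beta.
  move=> beta01; rewrite -lee_fin -lee_lne ?in_itv/= ?leey ?lee_fin
    ?chernoff_sum_ge0// -leeN2 -CE.
  by apply: ereal_sup_ubound; exists beta.
pose q0 := pair_law pi P0; pose q1 := pair_law pi P1.
have q0_ge0 z : 0 <= q0 z by rewrite mulr_ge0.
have q1_ge0 z : 0 <= q1 z by rewrite mulr_ge0.
pose l (z : X * X) := ln (P0 z.1 z.2) - ln (P1 z.1 z.2).
pose u (z : X * X) := if (0 < P0 z.1 z.2) && (0 < P1 z.1 z.2)
  then pi z.1 * P0 z.1 z.2 `^ alpha * P1 z.1 z.2 `^ (1 - alpha) else 0.
have u_ge0 z : 0 <= u z.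
  by rewrite /u; case: ifP => // _; rewrite !mulr_ge0 ?powR_ge0.
have u_tilt z t : 0 < P0 z.1 z.2 -> 0 < P1 z.1 z.2 ->
    u z * expR (t * l z) =
    pi z.1 * P0 z.1 z.2 `^ (alpha + t) * P1 z.1 z.2 `^ (1 - (alpha + t)).
  by move=> P0z P1z; rewrite /u P0z P1z -[RHS]mulrA -powR_tilt// !mulrA.
have uE0 z : 0 < P0 z.1 z.2 -> 0 < P1 z.1 z.2 ->
    q0 z = u z * expR ((1 - alpha) * l z).
  move=> P0z P1z; rewrite u_tilt// (_ : alpha + (1 - alpha) = 1); last by ring.
  by rewrite subrr powRr0 powRr1// mulr1.
have uE1 z : 0 < P0 z.1 z.2 -> 0 < P1 z.1 z.2 ->
    q1 z = u z * expR (- alpha * l z).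
  by move=> P0z P1z; rewrite u_tilt// subrr subr0 powRr0 powRr1// mulr1.
have u0 z : ~~ ((0 < P0 z.1 z.2) && (0 < P1 z.1 z.2)) -> u z = 0.
  by rewrite /u => /negbTE ->.
have uq0 z : u z * expR ((1 - alpha) * l z) <= q0 z.
  have [/andP[P0z P1z]|/u0 ->] := boolP ((0 < P0 z.1 z.2) && (0 < P1 z.1 z.2)).
    by rewrite -uE0.
  by rewrite mul0r.
have uq1 z : u z * expR (- alpha * l z) <= q1 z.
  have [/andP[P0z P1z]|/u0 ->] := boolP ((0 < P0 z.1 z.2) && (0 < P1 z.1 z.2)).
    by rewrite -uE1.
  by rewrite mul0r.
have quE z : q0 z != 0 -> q1 z != 0 ->
    q0 z = u z * expR ((1 - alpha) * l z) /\ q1 z = u z * expR (- alpha * l z).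
  rewrite !mulf_eq0 !negb_or => /andP[_ P0z] /andP[_ P1z].
  by split; [apply: uE0|apply: uE1]; rewrite lt0r ?P0z ?P1z/=.
have uc : \sum_z u z = chernoff_sum pi P0 P1 alpha.
  by rewrite /chernoff_sum [RHS]big_mkcond.
have a01 : 0 <= 1 - alpha <= 1.
  by case/andP: alpha01 => ? ?; apply/andP; split; lra.
have Pe_le n : best_bayes_error pi P0 P1 pi0 pi1 n <=
    chernoff_sum pi P0 P1 alpha ^+ n.
  have [pi0W pi1W] := (ltW pi00, ltW pi10).
  apply: (@le_trans _ _ (\sum_(z : n.-tuple (X * X))
    Num.min (\prod_(i < n) q0 (tnth z i)) (\prod_(i < n) q1 (tnth z i)))).
    exact: best_bayes_error_le.
  by rewrite -uc; exact: (sum_min_le_tilt q0 q1 u l (1 - alpha) alpha).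
rewrite CE.
have := chernoff_sum_ge0 P0 P1 alpha pi_ge0.
rewrite le_eqVlt => /predU1P[c0|c0].
  (* Case c = 0: the error is at most 0^n, so its logarithm is -oo for n > 0. The shift skips n = 0,
     where the bound is 0^0 = 1. *)
  rewrite -c0 le0_lneNy ?lexx// -cvg_shiftS.
  apply: (@cvg_near_cst _ _ (- -oo)%E); apply: nearW => n.
  have := Pe_le n.+1; rewrite -c0 expr0n/= => Pe0.
  rewrite -[LHS]/(- ((n.+1%:R^-1)%:E *
    lne (best_bayes_error pi P0 P1 pi0 pi1 n.+1)%:E))%E.
  by rewrite le0_lneNy ?lee_fin// gt0_muleNy// lte_fin invr_gt0 ltr0n.
(* The segment from [alpha] to [beta] stays in [0, 1], so [cmin] applies along it. Taking beta = 1
   and beta = 0 gives the two sign conditions on the mean. *)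
have mean beta : 0 <= beta <= 1 -> 0 <= (beta - alpha) * \sum_z u z * l z.
  move=> beta01; apply: expR_sum_min_mean => // t t01.
  apply: (@le_trans _ _ (chernoff_sum pi P0 P1 (alpha + t * (beta - alpha)))).
    rewrite uc; apply: cmin; move: alpha01 beta01 t01.
    by move=> /andP[? ?] /andP[? ?] /andP[? ?]; apply/andP; split; nra.
  rewrite /chernoff_sum big_mkcond/=; apply: ler_sum => z _.
  case: ifPn => [/andP[P0z P1z]|/u0 ->]; last by rewrite mul0r.
  by rewrite u_tilt.
have mE : \sum_z u z / (\sum_z u z) * l z = (\sum_z u z * l z) / \sum_z u z.
  by rewrite mulr_suml; apply: eq_bigr => z _; rewrite mulrAC.
rewrite lne_EFin//.
have k0 : 0 < Num.min pi0 pi1 by rewrite lt_min pi00.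
rewrite -EFinN.
apply: (cvg_exponent _ (best_bayes_error pi P0 P1 pi0 pi1)
  _ _ _ c0 k0) => [n _|n n0]; first exact: Pe_le.
apply: le_trans (best_bayes_error_ge _ _ _ _ _ (ltW pi00) (ltW pi10) _ _ _)
  => //.
rewrite ler_pM2l// -uc.
apply: (sum_min_ge_tilt q0 q1 u l (1 - alpha) alpha) => //.
- by rewrite uc.
- rewrite mE mulrA divr_ge0 ?uc ?(ltW c0)//; apply: mean; lra.
- rewrite mE mulrA mulr_le0_ge0 ?invr_ge0 ?uc ?(ltW c0)//.
  have := mean 0; rewrite lexx ler01 => /(_ isT); lra.
Qed.
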